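(* Let $D \subseteq \mathbb{B}^2$ be a Lebesgue-measurable set such that $0<\Lambda(D)<+\infty$. Then there exists a unique point $c=c(D)\in\mathbb{B}^2$ such that $$\int_{D} g_c(z)\, d\Lambda(z)=0,$$ where $g_c(z)=e^{i\theta}\frac{c-z}{1-\bar c z}$ with arbitrary $\theta\in[0,2\pi)$.
   Context: $\mathbb{B}^2=\{z\in\mathbb{C}: |z|<1\}$ is the open unit disc. The hyperbolic measure on $\mathbb{B}^2$ is $d\Lambda(z)=\frac{d\lambda(z)}{(1-|z|^2)^2}$, where $\lambda$ is Lebesgue measure on $\mathbb{C}$. The factor $e^{i\theta}$ plays no role in whether the integral vanishes. *)

(* Defs.v *)
From HB Require Import structures.
From mathcomp Require Import all_boot all_order all_algebra.
From mathcomp Require Import all_classical all_reals all_analysis.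
From mathcomp Require Import measurable_realfun complex.

Set Implicit Arguments.
Unset Strict Implicit.
Unset Printing Implicit Defensive.

Import Order.TTheory GRing.Theory Num.Theory.
Import numFieldNormedType.Exports.
Import Normc.

Local Open Scope classical_set_scope.
Local Open Scope ring_scope.
Local Open Scope complex_scope.

Section lebesgue_complex.
Context {R : realType}.

Let lambda1 := @lebesgue_measure R.

(* The completion (Caratheodory extension) of the product measure, so that its
   measurable sets are the Lebesgue, and not only the Borel, sets of R^2. *)
Definition lebesgue_plane :=
  @completed_measure_extension _ _ R (lambda1 \x lambda1)%E.
HB.instance Definition _ := Measure.on lebesgue_plane.

Definition plane := caratheodory_type ((lambda1 \x lambda1)^*)%E%mu.
HB.instance Definition _ := Measurable.on plane.

Definition complex_of_pair (p : plane) : R[i] := p.1 +i* p.2.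

HB.instance Definition _ := isPointed.Build R[i] 0.

Fact complex_lebesgue_display : measure_display. Proof. exact. Qed.

(* R[i] carries the Lebesgue sigma-algebra, transported from the plane. *)
Definition complex_lebesgue_measurable (A : set R[i]) :=
  measurable (complex_of_pair @^-1` A).

Let mC0 : complex_lebesgue_measurable set0.
Proof. by rewrite /complex_lebesgue_measurable preimage_set0. Qed.

Let mCC A : complex_lebesgue_measurable A ->
  complex_lebesgue_measurable (~` A).
Proof. by rewrite /complex_lebesgue_measurable preimage_setC => /measurableC. Qed.

Let mCU (F : (set R[i])^nat) : (forall i, complex_lebesgue_measurable (F i)) ->
  complex_lebesgue_measurable (\bigcup_i F i).
Proof.
by rewrite /complex_lebesgue_measurable preimage_bigcup => /bigcupT_measurable.
Qed.

HB.instance Definition _ := isMeasurable.Build complex_lebesgue_display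
  R[i] mC0 mCC mCU.

Definition lebesgue_complex (A : set R[i]) : \bar R :=
  lebesgue_plane (complex_of_pair @^-1` A).

Let lC0 : lebesgue_complex set0 = 0%E.
Proof. by rewrite /lebesgue_complex preimage_set0 measure0. Qed.

Let lC_ge0 A : (0 <= lebesgue_complex A)%E.
Proof. exact: measure_ge0. Qed.

Let lC_sigma_additive : semi_sigma_additive lebesgue_complex.
Proof.
move=> F mF tF mUF; rewrite /lebesgue_complex preimage_bigcup /=.
apply: measure_semi_sigma_additive => //.
apply/trivIsetP => /= i j _ _ ij; rewrite -preimage_setI.
by move/trivIsetP : tF => /(_ _ _ _ _ ij) ->//; rewrite preimage_set0.
Qed.

HB.instance Definition _ := isMeasure.Build _ R[i] R
  lebesgue_complex lC0 lC_ge0 lC_sigma_additive.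

Lemma measurable_complex (A : set R[i]) :
  @measurable _ (measurableTypeR R * measurableTypeR R)%type
    [set p | A (p.1 +i* p.2)] ->
  measurable A.
Proof. exact: caratheodory_measurable_mu_ext. Qed.

Lemma measurable_Re : measurable_fun setT (@complex.Re R).
Proof.
move=> _ B mB; rewrite setTI; apply: measurable_complex.
have := @measurable_fst _ _ (measurableTypeR R) (measurableTypeR R).
by move=> /(_ measurableT B mB); rewrite setTI.
Qed.

Lemma measurable_Im : measurable_fun setT (@complex.Im R).
Proof.
move=> _ B mB; rewrite setTI; apply: measurable_complex.
have := @measurable_snd _ _ (measurableTypeR R) (measurableTypeR R).
by move=> /(_ measurableT B mB); rewrite setTI.
Qed.

Lemma measurable_normc : measurable_fun setT (@normc R).
Proof.
rewrite (_ : @normc R =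
  fun z => Num.sqrt (complex.Re z ^+ 2 + complex.Im z ^+ 2)); last first.
  by apply/funext => -[].
apply: measurableT_comp.
  by apply: continuous_measurable_fun; exact: sqrt_continuous.
by apply: measurable_funD; apply: measurable_funX;
  [exact: measurable_Re | exact: measurable_Im].
Qed.

End lebesgue_complex.

Section hyperbolic.
Context {R : realType}.

Definition unit_disc : set R[i] := [set z | `|z| < 1].

(* Only integrated over the disc, where the denominator is positive. *)
Definition hyperbolic_density (z : R[i]) : R := ((1 - normc z ^+ 2) ^+ 2)^-1.

Lemma measurable_unit_disc : measurable unit_disc.
Proof.
have := @measurable_normc R measurableT _ (measurable_itv `]-oo, (1:R)[).
rewrite setTI; congr measurable; apply/seteqP.
by split => -[a b] /=; rewrite /unit_disc/= in_itv/= ltcR.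
Qed.

Lemma measurable_hyperbolic_density : measurable_fun setT hyperbolic_density.
Proof.
rewrite (_ : hyperbolic_density =
  fun z => ((1 - normc z ^+ 2) ^+ 2) `^ (-1)); last first.
  by apply/funext => z; rewrite powR_inv1// sqr_ge0.
apply: (measurableT_comp (measurable_powR _)).
apply: measurable_funX; apply: measurable_funB; first exact: measurable_cst.
by apply: measurable_funX; exact: measurable_normc.
Qed.

Lemma hyperbolic_density_ge0 z : 0 <= hyperbolic_density z.
Proof. by rewrite invr_ge0 sqr_ge0. Qed.

Definition hyperbolic_measure (A : set R[i]) : \bar R :=
  (\int[lebesgue_complex]_(z in A `&` unit_disc) (hyperbolic_density z)%:E)%E.

Let h0 : hyperbolic_measure set0 = 0%E.
Proof. by rewrite /hyperbolic_measure set0I integral_set0. Qed.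

Let h_ge0 A : (0 <= hyperbolic_measure A)%E.
Proof.
by apply: integral_ge0 => z _; rewrite lee_fin hyperbolic_density_ge0.
Qed.

Let h_sigma_additive : semi_sigma_additive hyperbolic_measure.
Proof.
move=> F mF tF mUF; rewrite /hyperbolic_measure setI_bigcupl.
apply: (semi_sigma_additive_nng_induced (f := EFin \o hyperbolic_density)).
- by apply/measurable_EFinP; exact: measurable_hyperbolic_density.
- by move=> z; rewrite lee_fin hyperbolic_density_ge0.
- by move=> i; apply: measurableI => //; exact: measurable_unit_disc.
- exact: trivIset_setIr.
- rewrite -setI_bigcupl; apply: measurableI => //.
  exact: measurable_unit_disc.
Qed.

HB.instance Definition _ := isMeasure.Build _ R[i] R
  hyperbolic_measure h0 h_ge0 h_sigma_additive.

(* The Lebesgue integral of f when Re f and Im f are integrable; this is the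
   case for |f| <= 1 on a set of finite measure. *)
Definition complex_integral (mu : {measure set R[i] -> \bar R}) (D : set R[i])
    (f : R[i] -> R[i]) : R[i] :=
  (\int[mu]_(z in D) complex.Re (f z)) +i* (\int[mu]_(z in D) complex.Im (f z)).

Definition expi (theta : R) : R[i] := cos theta +i* sin theta.

Definition moebius (theta : R) (c z : R[i]) : R[i] :=
  expi theta * ((c - z) / (1 - conjc c * z)).

End hyperbolic.

(* Main.v *)
(* Write g_c z = (c - z) / (1 - c^* z) and w = g_c z, w' = g_c c'. The function
   X c z = |1 - c^* z|^2 / (1 - |c|^2) satisfies X c' z = X c z * X w' w, so with
   ln x <= x - 1 the energy E c = \int_D ln (X c z) obeys
     E c' - E c <= 2 (|w'|^2 m - Re (w'^* F c)) / (1 - |w'|^2),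
   where m is the mass of D and F c = \int_D g_c. This single inequality makes E
   locally Lipschitz, and shows F c = 0 at a minimum of E (take w' = t F c with t
   small). E is coercive because most of the mass of D lies in a smaller disc,
   so a minimum exists. For uniqueness, g_c' z is a constant of modulus 1 times
   (w' - w) / (1 - w'^* w), and
     Re (w'^* (w' - w) / (1 - w'^* w)) + Re (w'^* w) > 0 for w' <> 0. *)

Require Import Defs.
From mathcomp Require Import all_boot all_order all_algebra.
From mathcomp Require Import all_classical all_reals all_analysis.
From mathcomp Require Import measurable_realfun complex ring lra.

Import Order.TTheory GRing.Theory Num.Theory.
Import numFieldNormedType.Exports.
Import Normc.

Local Open Scope classical_set_scope.
Local Open Scope ring_scope.
Local Open Scope complex_scope.

(* [^*] in [ring_scope] would otherwise be [Num.conj], not [conjc]. *)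
Local Notation "x ^*" := (conjc x) : ring_scope.

(** * Algebra of the disc automorphisms and of the inverse Poisson kernel *)

Section disc_algebra.
Context {R : realType}.
Set Implicit Arguments.
Unset Strict Implicit.
Implicit Types c z w u k : R[i].

Definition blaschke c z : R[i] := (c - z) / (1 - c^* * z).

(* On |z| = 1 this is the inverse of the Poisson kernel. *)
Definition inv_poisson c z : R := normc (1 - c^* * z) ^+ 2 / (1 - normc c ^+ 2).

Lemma unit_discE z : unit_disc z <-> normc z < 1.
Proof. by case: z => a b; rewrite /unit_disc /= -ltcR. Qed.

Lemma sqr_normcE z : normc z ^+ 2 = complex.Re z ^+ 2 + complex.Im z ^+ 2.
Proof. by case: z => a b; rewrite /= sqr_sqrtr// addr_ge0 ?sqr_ge0. Qed.

Lemma normc_ge0 z : 0 <= normc z.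
Proof. by case: z => a b; exact: sqrtr_ge0. Qed.

Lemma normc_conjc z : normc z^* = normc z.
Proof. by case: z => a b; rewrite /= sqrrN. Qed.

Lemma normrRe_le z : `|complex.Re z| <= normc z.
Proof.
by case: z => a b; rewrite /= -sqrtr_sqr ler_wsqrtr// lerDl sqr_ge0.
Qed.

Lemma normrIm_le z : `|complex.Im z| <= normc z.
Proof.
by case: z => a b; rewrite /= -sqrtr_sqr ler_wsqrtr// lerDr sqr_ge0.
Qed.

Lemma normc_le_add z : normc z <= `|complex.Re z| + `|complex.Im z|.
Proof.
have h : 0 <= `|complex.Re z| + `|complex.Im z| by rewrite addr_ge0.
rewrite -(ler_pXn2r (n := 2)) ?nnegrE ?normc_ge0//.
rewrite sqr_normcE sqrrD !real_normK ?num_real//.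
by rewrite addrAC lerDl mulrn_wge0// mulr_ge0.
Qed.

Lemma sqr_normc_1B u : normc (1 - u) ^+ 2 = 1 - 2 * complex.Re u + normc u ^+ 2.
Proof. by case: u => a b; rewrite !sqr_normcE /=; ring. Qed.

Lemma mulcJ z : z^* * z = (normc z)%:C ^+ 2.
Proof.
rewrite -rmorphXn /= sqr_normcE; case: z => a b.
apply/eqP; rewrite eq_complex /=.
by apply/andP; split; apply/eqP; ring.
Qed.

Lemma normc_sqr_lt1 z : normc z < 1 -> 0 < 1 - normc z ^+ 2.
Proof. by move=> z1; rewrite subr_gt0 exprn_ilt1// normc_ge0. Qed.

Lemma normc_conjM_lt1 c z : normc c < 1 -> normc z <= 1 -> normc (c^* * z) < 1.
Proof.
move=> c1 z1; rewrite normcM normc_conjc.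
by apply: le_lt_trans c1; rewrite ler_piMr// normc_ge0.
Qed.

Lemma normc_1B_ge u : 1 - normc u <= normc (1 - u).
Proof.
rewrite lerBlDr (le_trans _ (le_normcD _ _))//.
by rewrite subrK normc1.
Qed.

Lemma normc_1B_le u : normc (1 - u) <= 1 + normc u.
Proof. by rewrite (le_trans (le_normcD _ _))// normcN normc1. Qed.

Lemma normc_1BJ_gt0 c z : normc c < 1 -> normc z <= 1 ->
  0 < normc (1 - c^* * z).
Proof.
move=> c1 z1; apply: lt_le_trans (normc_1B_ge _).
by rewrite subr_gt0 normc_conjM_lt1.
Qed.

Lemma subr1J_neq0 c z : normc c < 1 -> normc z <= 1 -> 1 - c^* * z != 0.
Proof.
move=> c1 z1; apply/negP => /eqP h.
by have := normc_1BJ_gt0 c1 z1; rewrite h normc0 ltxx.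
Qed.

Lemma inv_poisson_gt0 c z : normc c < 1 -> normc z <= 1 -> 0 < inv_poisson c z.
Proof.
by move=> c1 z1; rewrite divr_gt0 ?normc_sqr_lt1// exprn_gt0// normc_1BJ_gt0.
Qed.

Lemma conjcBJ c z : (1 - c^* * z)^* = 1 - c * z^*.
Proof. by rewrite rmorphB rmorphM rmorph1 /= conjcK. Qed.

Lemma conjc_blaschke c z : (blaschke c z)^* = (c^* - z^*) / (1 - c * z^*).
Proof. by rewrite /blaschke rmorphM /= conjc_inv conjcBJ rmorphB. Qed.

Lemma subr1J_neq0C c z : normc c < 1 -> normc z <= 1 -> 1 - c * z^* != 0.
Proof. by move=> c1 z1; rewrite -conjcBJ conjc_eq0 subr1J_neq0. Qed.

(** Two-point form of the classical identity for 1 - |g_c z|^2, which is the case [c' = z]. It also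
    feeds [blaschke_shift] and the cocycle relation. *)
Lemma blaschke_1BJ c c' z : normc c < 1 -> normc c' < 1 -> normc z <= 1 ->
  1 - (blaschke c c')^* * blaschke c z =
  (1 - c^* * c) * (1 - c'^* * z) / ((1 - c * c'^*) * (1 - c^* * z)).
Proof.
move=> c1 c'1 z1; rewrite conjc_blaschke /blaschke.
have n1 := subr1J_neq0 c1 z1.
have n2 := subr1J_neq0C c1 (ltW c'1).
by field; rewrite n1 n2.
Qed.

Lemma blaschkeK c w : normc c < 1 -> normc w <= 1 ->
  blaschke c (blaschke c w) = w.
Proof.
move=> c1 w1; rewrite /blaschke.
have n1 := subr1J_neq0 c1 w1.
have n2 := subr1J_neq0 c1 (ltW c1).
field; rewrite n1/= (_ : 1 - _ - _ = 1 - c^* * c)//=; ring.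
Qed.

(** With w' = g_c c', the maps g_w' o g_c and g_c' are disc automorphisms that both vanish at [c'],
    so they agree up to a constant of modulus 1, here explicit. *)
Lemma blaschke_shift c c' z : normc c < 1 -> normc c' < 1 -> normc z <= 1 ->
  (blaschke c c' - blaschke c z) / (1 - (blaschke c c')^* * blaschke c z) =
  - ((1 - c * c'^*) / (1 - c^* * c')) * blaschke c' z.
Proof.
move=> c1 c'1 z1; rewrite blaschke_1BJ// /blaschke.
have n1 := subr1J_neq0 c1 z1.
have n2 := subr1J_neq0C c1 (ltW c'1).
have n3 := subr1J_neq0 c1 (ltW c1).
have n4 := subr1J_neq0 c1 (ltW c'1).
have n5 := subr1J_neq0 c'1 z1.
by field; rewrite n1 n2 n3 n4 n5.
Qed.

Lemma one_sub_sqr_normc_blaschke c z : normc c < 1 -> normc z < 1 ->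
  1 - normc (blaschke c z) ^+ 2 =
  (1 - normc c ^+ 2) * (1 - normc z ^+ 2) / normc (1 - c^* * z) ^+ 2.
Proof.
move=> c1 z1; apply: complexI.
rewrite !(rmorphB, rmorphXn, rmorphM, rmorph1, fmorphV) /=.
rewrite -!mulcJ blaschke_1BJ//; last exact: ltW.
by rewrite conjcBJ.
Qed.

Lemma normc_blaschke_lt1 c z : normc c < 1 -> normc z < 1 ->
  normc (blaschke c z) < 1.
Proof.
move=> c1 z1; rewrite -(@ltr_pXn2r _ 2) ?nnegrE ?normc_ge0//.
rewrite expr1n -subr_gt0 one_sub_sqr_normc_blaschke//.
apply: divr_gt0; first by apply: mulr_gt0; exact: normc_sqr_lt1.
by apply: exprn_gt0; apply: normc_1BJ_gt0 => //; exact: ltW.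
Qed.

Lemma normc_real (x : R) : normc x%:C = `|x|.
Proof. by rewrite /= expr0n addr0 sqrtr_sqr. Qed.

(** [inv_poisson c z] is the ratio of 1 - |z|^2 to 1 - |g_c z|^2. Since g_w' (g_c z) and g_c' z have
    the same modulus, the product of ratios telescopes. *)
Lemma inv_poisson_cocycle c c' z : normc c < 1 -> normc c' < 1 -> normc z < 1 ->
  inv_poisson c' z =
  inv_poisson c z * inv_poisson (blaschke c c') (blaschke c z).
Proof.
move=> c1 c'1 z1; rewrite /inv_poisson one_sub_sqr_normc_blaschke//.
rewrite blaschke_1BJ ?(ltW z1)// mulcJ.
have n1 := lt0r_neq0 (normc_1BJ_gt0 c1 (ltW z1)).
have n2 := lt0r_neq0 (normc_1BJ_gt0 c1 (ltW c'1)).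
have n3 := lt0r_neq0 (normc_sqr_lt1 c1).
have n4 := lt0r_neq0 (normc_sqr_lt1 c'1).
rewrite normcM normcV !normcM -(conjcBJ c c') normc_conjc.
rewrite -rmorphXn -(rmorph1 (real_complex R)) -rmorphB normc_real.
rewrite ger0_norm; last by rewrite ltW// normc_sqr_lt1.
by field; rewrite n1 n2 n3 n4.
Qed.

Lemma normc_1BJ_le2 c z : normc c < 1 -> normc z <= 1 ->
  normc (1 - c^* * z) <= 2.
Proof.
move=> c1 z1; rewrite (le_trans (normc_1B_le _))// -[leRHS]/(1 + 1).
by rewrite lerD2l ltW// normc_conjM_lt1.
Qed.

(** For [z] in a fixed smaller disc the value blows up as |c| tends to 1; this drives coercivity. *)
Lemma inv_poisson_ge c z r : normc c < 1 -> normc z <= r -> r <= 1 ->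
  (1 - r) ^+ 2 / (1 - normc c ^+ 2) <= inv_poisson c z.
Proof.
move=> c1 zr r1; rewrite ler_wpM2r ?invr_ge0 ?(ltW (normc_sqr_lt1 c1))//.
rewrite lerXn2r ?nnegrE ?normc_ge0 ?subr_ge0//.
apply: le_trans (normc_1B_ge _); rewrite lerD2l lerN2 normcM normc_conjc.
apply: le_trans zr; rewrite ler_piMl ?normc_ge0// ltW//.
Qed.

(** Worst case, with [z] allowed near the circle: the value decays at most linearly in 1 - |c|^2. *)
Lemma inv_poisson_ge_far c z : normc c < 1 -> normc z <= 1 ->
  (1 - normc c ^+ 2) / 4 <= inv_poisson c z.
Proof.
move=> c1 z1; rewrite ler_pdivlMr ?normc_sqr_lt1//.
apply: (@le_trans _ _ ((1 - normc c) ^+ 2)).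
  rewrite [leLHS](_ : _ = (1 - normc c) ^+ 2 * ((1 + normc c) / 2) ^+ 2).
    rewrite ler_piMr ?sqr_ge0// exprn_ile1 ?divr_ge0 ?addr_ge0 ?normc_ge0//.
    by rewrite ler_pdivrMr//; move: c1; lra.
  by field.
rewrite lerXn2r ?nnegrE ?normc_ge0 ?subr_ge0 ?(ltW c1)//.
apply: le_trans (normc_1B_ge _); rewrite lerD2l lerN2 normcM normc_conjc.
by rewrite ler_piMr ?normc_ge0.
Qed.

Lemma inv_poisson_le c z : normc c < 1 -> normc z <= 1 ->
  inv_poisson c z <= 4 / (1 - normc c ^+ 2).
Proof.
move=> c1 z1; rewrite ler_wpM2r ?invr_ge0 ?(ltW (normc_sqr_lt1 c1))//.
rewrite (_ : 4 = 2 ^+ 2); last by rewrite -natrX.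
by rewrite lerXn2r ?nnegrE ?normc_ge0// normc_1BJ_le2.
Qed.

Lemma ln_inv_poisson_sub_le c c' z :
  normc c < 1 -> normc c' < 1 -> normc z < 1 ->
  ln (inv_poisson c' z) - ln (inv_poisson c z) <=
  2 * (normc (blaschke c c') ^+ 2 -
       complex.Re ((blaschke c c')^* * blaschke c z)) /
  (1 - normc (blaschke c c') ^+ 2).
Proof.
move=> c1 c'1 z1; have w1 := normc_blaschke_lt1 c1 z1.
have w'1 := normc_blaschke_lt1 c1 c'1.
have k0 := inv_poisson_gt0 c1 (ltW z1).
have k'0 := inv_poisson_gt0 w'1 (ltW w1).
have d0 := normc_sqr_lt1 w'1.
rewrite (@inv_poisson_cocycle c c')// lnM ?posrE// addrAC subrr add0r.
apply: (@le_trans _ _ (inv_poisson (blaschke c c') (blaschke c z) - 1)).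
  by rewrite -[X in ln X](subrKC 1) le_ln1Dx// ltrBrDl subrr.
rewrite ler_pdivlMr// mulrBl mul1r /inv_poisson mulfVK ?lt0r_neq0//.
(* With w = g_c z, w' = g_c c' and u = w'^* w, expanding |1 - u|^2 leaves only |w'|^2 |w|^2 <=
   |w'|^2 to check. *)
rewrite sqr_normc_1B normcM normc_conjc exprMn.
have := normc_sqr_lt1 w1; have := sqr_ge0 (normc (blaschke c c')).
nra.
Qed.

Lemma normc_blaschkeC c c' : normc c < 1 -> normc c' < 1 ->
  normc (blaschke c c') = normc (blaschke c' c).
Proof.
move=> c1 c'1; rewrite /blaschke !normcM !normcV -opprB normcN; congr (_ / _).
by rewrite -normc_conjc conjcBJ mulrC.
Qed.

(** Turns Euclidean closeness of [c] and [c'] into smallness of |g_c c'|, the distance in which the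
    energy is Lipschitz. *)
Lemma normc_blaschke_le c c' : normc c < 1 -> normc c' < 1 ->
  normc (blaschke c c') <= normc (c - c') / (1 - normc c).
Proof.
move=> c1 c'1; rewrite normcM normcV ler_wpM2l ?normc_ge0//.
rewrite lef_pV2 ?posrE ?subr_gt0 ?(normc_1BJ_gt0 c1 (ltW c'1))//.
apply: le_trans (normc_1B_ge _); rewrite lerD2l lerN2 normcM normc_conjc.
by rewrite ler_piMr ?normc_ge0 ?ltW.
Qed.

Lemma Re_blaschke_add_gt0 w w' : w' != 0 -> normc w' < 1 -> normc w < 1 ->
  0 < complex.Re (w'^* * ((w' - w) / (1 - w'^* * w))) + complex.Re (w'^* * w).
Proof.
move=> w'0 w'1 w1; rewrite mulrA mulrBr mulcJ -rmorphXn /=.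
set a := normc w' ^+ 2.
have a0 : 0 < a.
  rewrite exprn_gt0// lt0r normc_ge0 andbT.
  by apply: contra w'0 => /eqP/eq0_normc ->.
have a1 : a < 1 by rewrite -subr_gt0 normc_sqr_lt1.
have ua : normc (w'^* * w) ^+ 2 < a.
  rewrite normcM normc_conjc exprMn gtr_pMr//.
  by rewrite -subr_gt0 normc_sqr_lt1.
move: ua; rewrite sqr_normcE; case: (w'^* * w) => u v /= uva.
have u1 : u < 1 by nra.
have d0 : 0 < (1 - u) ^+ 2 + (0 - v) ^+ 2.
  by rewrite ltr_pwDl ?sqr_ge0// exprn_gt0// subr_gt0.
(* Here u + iv stands for w'^* w. Since u^2 + v^2 < a < 1, the factors a - u^2, 1 - u and 1 + u are
   all positive. *)
rewrite [X in 0 < X](_ : _ = ((a - u ^+ 2) * (1 - u) + v ^+ 2 * (1 + u)) /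
  ((1 - u) ^+ 2 + (0 - v) ^+ 2)); last first.
  by field; move: d0; rewrite sub0r => /lt0r_neq0.
rewrite divr_gt0//.
nra.
Qed.

End disc_algebra.

(** * Measurability and integration of complex-valued functions *)

Section complex_integration.
Context {R : realType}.
Set Implicit Arguments.
Unset Strict Implicit.
Implicit Types (f g : R[i] -> R[i]) (k c z : R[i]).

(* Borel measurability: with the Lebesgue sigma-algebra on the codomain,
   measurability would not be stable under composition. *)
Definition cmeasurable f : Prop :=
  measurable_fun setT (@complex.Re R \o f) /\
  measurable_fun setT (@complex.Im R \o f).

Lemma cmeasurable_id : cmeasurable id.
Proof. by split; [exact: measurable_Re | exact: measurable_Im]. Qed.

Lemma cmeasurable_cst k : cmeasurable (cst k).
Proof. by split; exact: measurable_cst. Qed.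

Lemma cmeasurableB f g : cmeasurable f -> cmeasurable g ->
  cmeasurable (fun z => f z - g z).
Proof.
move=> [f1 f2] [g1 g2]; split.
- rewrite (_ : _ \o _ = (@complex.Re R \o f) \- (@complex.Re R \o g)).
    exact: measurable_funB.
  by apply/funext => z /=; case: (f z) (g z) => [? ?] [].
- rewrite (_ : _ \o _ = (@complex.Im R \o f) \- (@complex.Im R \o g)).
    exact: measurable_funB.
  by apply/funext => z /=; case: (f z) (g z) => [? ?] [].
Qed.

Lemma cmeasurableM f g : cmeasurable f -> cmeasurable g ->
  cmeasurable (fun z => f z * g z).
Proof.
move=> [f1 f2] [g1 g2]; split.
- rewrite (_ : _ \o _ = ((@complex.Re R \o f) \* (@complex.Re R \o g)) \-
    ((@complex.Im R \o f) \* (@complex.Im R \o g))).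
    by apply: measurable_funB; apply: measurable_funM.
  by apply/funext => z /=; case: (f z) (g z) => [? ?] [].
- rewrite (_ : _ \o _ = ((@complex.Re R \o f) \* (@complex.Im R \o g)) \+
    ((@complex.Im R \o f) \* (@complex.Re R \o g))).
    by apply: measurable_funD; apply: measurable_funM.
  by apply/funext => z /=; case: (f z) (g z) => [? ?] [].
Qed.

Lemma measurable_sqr_normc f : cmeasurable f ->
  measurable_fun setT (fun z => normc (f z) ^+ 2).
Proof.
move=> [f1 f2]; under eq_fun do rewrite sqr_normcE.
by apply: measurable_funD; apply: measurable_funX.
Qed.

Lemma cmeasurableV f : cmeasurable f -> cmeasurable (fun z => (f z)^-1).
Proof.
move=> mf; have [f1 f2] := mf.
(* The inverse is written as the real power -1 in order to use [measurable_powR]; the two agree on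
   nonnegative reals, including at 0. *)
have mn : measurable_fun setT (fun z => (normc (f z) ^+ 2) `^ (-1)).
  exact: (measurableT_comp (measurable_powR _) (measurable_sqr_normc mf)).
split.
- rewrite (_ : _ \o _ = (@complex.Re R \o f) \*
    (fun z => (normc (f z) ^+ 2) `^ (-1))).
    exact: measurable_funM.
  apply/funext => z /=; rewrite powR_inv1 ?sqr_ge0// sqr_normcE.
  by case: (f z).
- rewrite (_ : _ \o _ = (\- (@complex.Im R \o f)) \*
    (fun z => (normc (f z) ^+ 2) `^ (-1))).
    by apply: measurable_funM => //; exact: measurableT_comp.
  apply/funext => z /=; rewrite powR_inv1 ?sqr_ge0// sqr_normcE.
  by case: (f z) => a b /=; rewrite mulNr.
Qed.

Lemma cmeasurable_1BJ c : cmeasurable (fun z => 1 - c^* * z).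
Proof.
apply: cmeasurableB; first exact: cmeasurable_cst.
by apply: cmeasurableM; [exact: cmeasurable_cst | exact: cmeasurable_id].
Qed.

Lemma cmeasurable_blaschke c : cmeasurable (blaschke c).
Proof.
apply: cmeasurableM; last by apply: cmeasurableV; exact: cmeasurable_1BJ.
by apply: cmeasurableB; [exact: cmeasurable_cst | exact: cmeasurable_id].
Qed.

Lemma measurable_ln_inv_poisson c :
  measurable_fun setT (fun z => ln (inv_poisson c z)).
Proof.
apply: (measurableT_comp (@measurable_ln R)); apply: measurable_funM.
  by apply: measurable_sqr_normc; exact: cmeasurable_1BJ.
exact: measurable_cst.
Qed.

Context (mu : {measure set R[i] -> \bar R}) (D : set R[i]).
Hypothesis mD : measurable D.
Hypothesis muD : (mu D < +oo)%E.

Lemma bounded_integrable (h : R[i] -> R) (M : R) : measurable_fun setT h ->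
  (forall z, D z -> `|h z| <= M) -> mu.-integrable D (EFin \o h).
Proof.
move=> mh hM; apply: measurable_bounded_integrable => //.
  exact: measurable_funTS.
exists M; split; first exact: num_real.
by move=> x Mx z Dz /=; rewrite (le_trans (hM z Dz))// ltW.
Qed.

Lemma bounded_integrable_ReIm f (M : R) : cmeasurable f ->
  (forall z, D z -> normc (f z) <= M) ->
  mu.-integrable D (EFin \o (@complex.Re R \o f)) /\
  mu.-integrable D (EFin \o (@complex.Im R \o f)).
Proof.
move=> [f1 f2] fM; split; apply: (@bounded_integrable _ M) => // z Dz.
  exact: le_trans (normrRe_le _) (fM z Dz).
exact: le_trans (normrIm_le _) (fM z Dz).
Qed.

Lemma complex_integralZ f (M : R) k : cmeasurable f ->
  (forall z, D z -> normc (f z) <= M) ->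
  complex_integral mu D (fun z => k * f z) = k * complex_integral mu D f.
Proof.
move=> mf fM; have [i1 i2] := bounded_integrable_ReIm mf fM.
have iZ r (h : R[i] -> R) : mu.-integrable D (EFin \o h) ->
    mu.-integrable D (EFin \o (fun z => r * h z)).
  by move=> ih; have := integrableZl mD r ih.
case: k => a b; rewrite /complex_integral; apply/eqP; rewrite eq_complex /=.
apply/andP; split; apply/eqP.
- rewrite -!RintegralZl// -RintegralB//; [|exact: iZ..].
  by apply: eq_Rintegral => z _; case: (f z).
- rewrite -!RintegralZl// -RintegralD//; [|exact: iZ..].
  by apply: eq_Rintegral => z _; case: (f z).
Qed.

(** A zero integral would force [h] to vanish almost everywhere on [D], so [D] would lie in a null
    set. *)
Lemma Rintegral_gt0 (h : R[i] -> R) : (0 < mu D)%E ->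
  mu.-integrable D (EFin \o h) -> (forall z, D z -> 0 < h z) ->
  0 < \int[mu]_(z in D) h z.
Proof.
move=> D0 ih h0; rewrite lt0r Rintegral_ge0 ?andbT; last first.
  by move=> z Dz; exact/ltW/h0.
apply/eqP => I0.
have E0 : (\int[mu]_(z in D) `|(h z)%:E| = 0)%E.
  rewrite -[RHS]/(0%:E) -I0 /Rintegral fineK ?integrable_fin_num//.
  apply: eq_integral => z; rewrite inE => Dz.
  by rewrite gee0_abs// lee_fin ltW// h0.
have [N [mN N0 subN]] := (ae_eq_integral_abs mu mD (measurable_int mu ih)).1 E0.
have : (mu D <= mu N)%E.
  apply: le_measure; rewrite ?inE// => z Dz; apply: subN => /(_ Dz) /=.
  by move=> [] hz; have := h0 z Dz; rewrite hz ltxx.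
by rewrite N0 leNgt D0.
Qed.
End complex_integration.

(** * Energy, its increments, and the moment at a minimum *)

Section conformal_barycenter.
Context {R : realType}.
Set Implicit Arguments.
Unset Strict Implicit.
Implicit Types (c w z : R[i]).

Context (mu : {measure set R[i] -> \bar R}) (D : set R[i]).
Hypothesis mD : measurable D.
Hypothesis D1 : forall z, D z -> normc z < 1.
Hypothesis D_gt0 : (0 < mu D)%E.
Hypothesis D_fin : (mu D < +oo)%E.

(* Up to a constant, -\int_D ln (1 - |g_c z|^2); dropping the term
   ln (1 - |z|^2), which need not be integrable, makes the integrand bounded. *)
Definition energy c : R := \int[mu]_(z in D) ln (inv_poisson c z).

Definition moment c : R[i] := complex_integral mu D (blaschke c).

Let m : R := fine (mu D).

Let m_gt0 : 0 < m.
Proof. by rewrite fine_gt0// D_gt0. Qed.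

Lemma integrable_ln_inv_poisson c : normc c < 1 ->
  mu.-integrable D (EFin \o (fun z => ln (inv_poisson c z))).
Proof.
(* The upper bound 4 / (1 - |c|^2) and the lower bound of [inv_poisson] are mutually inverse, so [q]
   bounds the logarithm on both sides. *)
move=> c1; set q := ln (4 / (1 - normc c ^+ 2)).
apply: (@bounded_integrable _ mu D mD D_fin _ q) => //.
  exact: measurable_ln_inv_poisson.
have d0 := normc_sqr_lt1 c1.
move=> z /D1/ltW z1; have k0 := inv_poisson_gt0 c1 z1.
rewrite ler_norml; apply/andP; split; last first.
  by rewrite ler_ln ?posrE ?k0 ?divr_gt0// inv_poisson_le.
rewrite /q -lnV ?posrE ?divr_gt0// invf_div.
by rewrite ler_ln ?posrE ?k0 ?divr_gt0// inv_poisson_ge_far.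
Qed.

Lemma moment_linear w c : normc c < 1 ->
  complex_integral mu D (fun z => w * blaschke c z) = w * moment c.
Proof.
move=> c1.
have b1 z : D z -> normc (blaschke c z) <= 1.
  by move=> /D1 z1; rewrite ltW// normc_blaschke_lt1.
exact: (complex_integralZ mD D_fin w (cmeasurable_blaschke c) b1).
Qed.

Lemma integrable_Re_blaschke w c : normc c < 1 ->
  mu.-integrable D (EFin \o (fun z => complex.Re (w * blaschke c z))).
Proof.
move=> c1.
have mw : cmeasurable (fun z => w * blaschke c z).
  exact: (cmeasurableM (cmeasurable_cst w) (cmeasurable_blaschke c)).
have bw z : D z -> normc (w * blaschke c z) <= normc w.
  move=> /D1 z1; rewrite normcM ler_piMr ?normc_ge0//.
  by rewrite ltW// normc_blaschke_lt1.
exact: (bounded_integrable_ReIm mD D_fin mw bw).1.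
Qed.

Lemma integrable_cst (x : R) : mu.-integrable D (EFin \o cst x).
Proof.
apply: (@bounded_integrable _ mu D mD D_fin _ `|x|) => //.
Qed.

Lemma energy_sub_le c c' : normc c < 1 -> normc c' < 1 ->
  energy c' - energy c <=
  2 * (normc (blaschke c c') ^+ 2 * m -
       complex.Re ((blaschke c c')^* * moment c)) /
  (1 - normc (blaschke c c') ^+ 2).
Proof.
move=> c1 c'1; set w := blaschke c c'.
rewrite /energy -RintegralB//; [|exact: integrable_ln_inv_poisson..].
rewrite -moment_linear// [complex.Re _]/=.
have i1 := integrable_cst (normc w ^+ 2).
have i2 := integrable_Re_blaschke w^* c1.
have i3 : mu.-integrable D (EFin \o
    (fun z => normc w ^+ 2 - complex.Re (w^* * blaschke c z))).
  by have := integrableB mD i1 i2.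
rewrite -Rintegral_cst// -RintegralB// mulrAC mulrC -RintegralZr//.
apply: le_Rintegral => //.
- by have := integrableB mD (integrable_ln_inv_poisson c'1)
    (integrable_ln_inv_poisson c1).
- by have := integrableZr mD (2 / (1 - normc w ^+ 2)) i3.
move=> z /D1 z1; apply: le_trans (ln_inv_poisson_sub_le c1 c'1 z1) _.
by rewrite -/w mulrAC mulrC.
Qed.

Lemma Re_moment_ge w c :
  normc c < 1 -> - (normc w * m) <= complex.Re (w * moment c).
Proof.
move=> c1; rewrite -moment_linear// [complex.Re _]/= -mulNr -Rintegral_cst//.
apply: le_Rintegral => //.
- exact: integrable_cst.
- exact: integrable_Re_blaschke.
move=> z /D1 z1; rewrite lerNl.
apply: le_trans (_ : normc (w * blaschke c z) <= _).
  by apply: le_trans (normrRe_le _); rewrite -normrN ler_norm.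
by rewrite normcM ler_piMr ?normc_ge0// ltW// normc_blaschke_lt1.
Qed.

Lemma energy_lipschitz c c' : normc c < 1 -> normc c' < 1 ->
  normc (blaschke c c') <= 2^-1 ->
  `|energy c - energy c'| <= 4 * m * normc (blaschke c c').
Proof.
(* A one-sided bound suffices, because |g_c c'| is symmetric in [c] and [c']. *)
have H c1 c2 : normc c1 < 1 -> normc c2 < 1 -> normc (blaschke c1 c2) <= 2^-1 ->
    energy c2 - energy c1 <= 4 * m * normc (blaschke c1 c2).
  move=> h1 h2 h; apply: le_trans (energy_sub_le h1 h2) _.
  have := Re_moment_ge (blaschke c1 c2)^* h1; rewrite normc_conjc.
  have := normc_ge0 (blaschke c1 c2); move: h.
  move: (normc _) (complex.Re _) => x y h x0 xy.
  rewrite ler_pdivrMr; last by nra.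
  (* Dividing by m x (1 + x) reduces the claim to 2 <= 4 (1 - x), which is where [x <= 2^-1] and the
     constant 4 come from. *)
  apply: (@le_trans _ _ (2 * (x ^+ 2 * m + x * m))); first by nra.
  rewrite [leLHS](_ : _ = m * x * (1 + x) * 2); last by ring.
  rewrite [leRHS](_ : _ = m * x * (1 + x) * (4 * (1 - x))); last by ring.
  apply: ler_wpM2l; last by lra.
  by rewrite !mulr_ge0// ?ltW// ltr_pwDl.
move=> h1 h2 h; rewrite ler_norml; apply/andP; split.
  by rewrite lerNl opprB H.
by rewrite normc_blaschkeC// H// normc_blaschkeC.
Qed.

Lemma moment_eq0 c : normc c < 1 ->
  (forall c', normc c' < 1 -> energy c <= energy c') -> moment c = 0.
Proof.
move=> c1 cmin; set F := moment c.
have nF := normc_ge0 F.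
(* This [t] is small enough for both t |F| < 1, so that t F lies in the disc, and t m < 1, so that
   the energy would decrease. *)
pose t : R := (2 * m + normc F + 1)^-1.
have d0 : 0 < 2 * m + normc F + 1 by move: m_gt0; lra.
have t0 : 0 < t by rewrite invr_gt0.
have tE : t * (2 * m + normc F + 1) = 1 by rewrite mulVf// lt0r_neq0.
pose w := t%:C * F.
have nw : normc w = t * normc F by rewrite normcM normc_real gtr0_norm.
have w1 : normc w < 1.
  by rewrite nw -tE ltr_pM2l//; move: m_gt0; lra.
(* The competitor is g_c w; as g_c is an involution, its image under g_c is [w] itself. *)
have := energy_sub_le c1 (normc_blaschke_lt1 c1 w1).
rewrite blaschkeK ?(ltW w1)// => h.
have : 0 <= 2 * (normc w ^+ 2 * m - complex.Re (w^* * F)) / (1 - normc w ^+ 2).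
  by apply: le_trans h; rewrite subr_ge0 cmin// normc_blaschke_lt1.
rewrite ler_pdivlMr ?normc_sqr_lt1// mul0r pmulr_rge0// nw.
rewrite (_ : w^* * F = (t * normc F ^+ 2)%:C) ; last first.
  rewrite [RHS]rmorphM [X in _ = _ * X]rmorphXn.
  rewrite -[_%:C ^+ 2]mulcJ mulrA /w rmorphM.
  by congr (_ * _ * _); exact: conjc_real.
rewrite -[complex.Re _]/(t * normc F ^+ 2) => h2.
apply: eq0_normc; apply/eqP; apply: contraT => Fn0.
have F0 : 0 < normc F by rewrite lt0r Fn0.
have F20 : 0 < t * normc F ^+ 2 by rewrite mulr_gt0// exprn_gt0.
(* This product equals |w|^2 m - Re (w^* F), which minimality makes nonnegative. *)
have : (t * normc F ^+ 2) * (t * m - 1) < 0.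
  rewrite pmulr_rlt0// subr_lt0 -tE ltr_pM2l//; move: m_gt0; lra.
by rewrite ltNge => /negP; case; move: h2; congr (_ <= _); ring.
Qed.

(** * Coercivity of the energy *)

Lemma energy0 : energy 0 = 0.
Proof.
rewrite /energy (@eq_Rintegral _ _ _ mu D (cst 0)) ?Rintegral_cst ?mul0r//.
move=> z _; rewrite /inv_poisson rmorph0 mul0r subr0 normc0 normc1.
by rewrite expr0n expr1n subr0 divr1 ln1.
Qed.

Lemma measurable_core r : measurable (D `&` [set z | normc z <= r]).
Proof.
apply: measurableI => //.
have := @measurable_normc R measurableT _ (measurable_itv `]-oo, r]).
by rewrite setTI; congr measurable; apply/seteqP; split=> z /=; rewrite in_itv.
Qed.

(** The discs of radius 1 - 1/(n+1) exhaust [D], so by continuity from below their share of the mass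
    eventually exceeds one half. *)
Lemma exists_heavy_core : exists2 r : R, r < 1 &
  m < 2 * fine (mu (D `&` [set z | normc z <= r])).
Proof.
pose F (n : nat) := D `&` [set z | normc z <= 1 - n.+1%:R^-1].
have UF : \bigcup_n F n = D.
  apply/seteqP; split => [z [n _ []]//|z Dz].
  have := D1 Dz; rewrite -subr_gt0 => z0.
  have [n _ nz] := near_infty_natSinv_lt (PosNum z0).
  exists n => //; split => //=; rewrite lerBrDl -lerBrDr ltW//.
  exact: (nz n (leqnn _)).
have cF : (mu \o F) n @[n --> \oo] --> mu D.
  rewrite -[in X in _ --> X]UF; apply: nondecreasing_cvg_mu.
  - by move=> n; exact: measurable_core.
  - by rewrite UF.
  - move=> a b ab; apply/subsetPset => z [Dz /= za]; split => //=.
    apply: le_trans za _; rewrite lerD2l lerN2 lef_pV2 ?posrE// ler_nat//.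
have {cF} : (fine \o (mu \o F)) n @[n --> \oo] --> m.
  by apply: fine_cvg; rewrite fineK// ge0_fin_numE.
have m2 : m / 2 < m by rewrite ltr_pdivrMr// ltr_pMr// ltr1n.
move=> /cvgr_gt/(_ _ m2)[n _ /(_ n (leqnn _)) /=].
rewrite ltr_pdivrMr// mulrC => mn.
by exists (1 - n.+1%:R^-1) => //; rewrite ltrBlDr ltrDl invr_gt0.
Qed.


(** On the core |z| <= r the integrand is at least [A], by [inv_poisson_ge]; on the rest it is at
    least [B], by [inv_poisson_ge_far]. For a heavy core the coefficient 2 m_r - m is positive, so
    the bound tends to infinity as |c| tends to 1. *)
Lemma energy_ge c r m_r : normc c < 1 -> r < 1 ->
  m_r = fine (mu (D `&` [set z | normc z <= r])) ->
  - ln (1 - normc c ^+ 2) * (2 * m_r - m) + 2 * ln (1 - r) * m_r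
    - ln 4 * (m - m_r) <= energy c.
Proof.
set E := D `&` [set z | normc z <= r] => c1 r1 m_rE.
have mE : measurable E := measurable_core r.
have mDE : measurable (D `\` E) by exact: measurableD.
have ED : E `<=` D by exact: subIsetl.
have DE : D = E `|` (D `\` E) by rewrite setDUK.
have E_fin : (mu E < +oo)%E.
  by apply: le_lt_trans D_fin; apply: le_measure; rewrite ?inE.
have DE_fin : (mu (D `\` E) < +oo)%E.
  by apply: le_lt_trans D_fin; apply: le_measure; rewrite ?inE// => z [].
have dE : [disjoint E & D `\` E].
  by apply/eqP; rewrite setDE setICA setICr setI0.
have mm : fine (mu (D `\` E)) = m - m_r.
  rewrite m_rE /m [in RHS]DE measureU//.
    by rewrite fineD ?ge0_fin_numE// addrAC subrr add0r.
  by rewrite setDE setICA setICr setI0.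
have ik := integrable_ln_inv_poisson c1.
have d0 := normc_sqr_lt1 c1.
have r0 : 0 < 1 - r by rewrite subr_gt0.
rewrite /energy {1}DE Rintegral_setU//; last by rewrite -DE.
set A := 2 * ln (1 - r) - ln (1 - normc c ^+ 2).
set B := ln (1 - normc c ^+ 2) - ln 4.
rewrite [leLHS](_ : _ = A * m_r + B * (m - m_r)); last by rewrite /A /B; ring.
rewrite -mm m_rE -!Rintegral_cst//; apply: lerD; apply: le_Rintegral => //.
- exact: (integrableS mD mE ED (integrable_cst A)).
- exact: (integrableS mD mE ED ik).
- move=> z [Dz /= zr]; have z1 := ltW (D1 Dz).
  have -> : A = ln ((1 - r) ^+ 2 / (1 - normc c ^+ 2)).
    by rewrite /A ln_div ?posrE ?exprn_gt0// lnXn// mulr_natl.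
  rewrite ler_ln ?posrE ?inv_poisson_gt0 ?divr_gt0 ?exprn_gt0//.
  by rewrite inv_poisson_ge// ltW.
- by apply: (integrableS mD mDE _ (integrable_cst B)) => z [].
- by apply: (integrableS mD mDE _ ik) => z [].
- move=> z [Dz _]; have z1 := ltW (D1 Dz).
  have -> : B = ln ((1 - normc c ^+ 2) / 4) by rewrite /B ln_div ?posrE.
  rewrite ler_ln ?posrE ?(inv_poisson_gt0 c1 z1) ?divr_gt0//.
  exact: inv_poisson_ge_far.
Qed.

Lemma energy_coercive : exists2 rho : R, rho < 1 &
  forall c, normc c < 1 -> rho <= normc c -> 0 < energy c.
Proof.
have [r r1 /=] := exists_heavy_core; set m_r := fine _ => mr.
(* [K] gathers the terms of the lower bound independent of [c]; the bound is positive as soon as 1 -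
   |c|^2 < q. *)
pose K := ln 4 * (m - m_r) - 2 * ln (1 - r) * m_r.
have s0 : 0 < 2 * m_r - m by rewrite subr_gt0.
pose q := expR (- (K / (2 * m_r - m))).
have q0 : 0 < q by exact: expR_gt0.
(* For |c| >= 1 - q/4, factoring gives 1 - |c|^2 <= 2 (q/4) < q. *)
exists (1 - q / 4); first by rewrite ltrBlDr ltrDl divr_gt0.
move=> c c1 hc; apply: lt_le_trans (energy_ge c1 r1 (erefl m_r)).
have d0 := normc_sqr_lt1 c1.
have : ln (1 - normc c ^+ 2) < - (K / (2 * m_r - m)).
  rewrite -ltr_expR lnK ?posrE// -/q.
  have := normc_ge0 c; nra.
rewrite ltrNr ltr_pdivrMr// /K; lra.
Qed.

(** * Continuity of the energy and existence of a minimum *)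

Lemma continuous_energy c : normc c < 1 ->
  {for (complex.Re c, complex.Im c),
    continuous (fun p : R * R => energy (p.1 +i* p.2))}.
Proof.
move=> c1; apply/cvgrPdist_lt => e e0 /=.
(* The first bound keeps [c'] in the disc and within range of [energy_lipschitz]; the second gives 4
   m b < e. *)
pose b := Num.min 2^-1 (e / (4 * m + 1)).
have b0 : 0 < b by rewrite lt_min invr_gt0 ltr0n divr_gt0//; move: m_gt0; lra.
have b2 : b <= 2^-1 by rewrite ge_min lexx.
have be : 4 * m * b < e.
  have : b <= e / (4 * m + 1) by rewrite ge_min lexx orbT.
  rewrite ler_pdivlMr; last by move: m_gt0; lra.
  by move: b0; lra.
(* Each coordinate contributes half of (1 - |c|) b, the Euclidean distance that [normc_blaschke_le]
   turns into |g_c c'| <= b. *)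
pose d := (1 - normc c) * b / 2.
have d0 : 0 < d by rewrite divr_gt0// mulr_gt0// subr_gt0.
have := nbhsx_ballx (complex.Re c, complex.Im c) _ d0.
apply: filterS => -[x y] [/= hx hy].
have -> : complex.Re c +i* complex.Im c = c by case: (c).
have cc' : normc (c - (x +i* y)) < (1 - normc c) * b.
  apply: le_lt_trans (normc_le_add _) _; rewrite [ltRHS]splitr.
  have [-> ->] : complex.Re (c - (x +i* y)) = complex.Re c - x /\
      complex.Im (c - (x +i* y)) = complex.Im c - y by case: (c).
  exact: ltrD.
have c'1 : normc (x +i* y) < 1.
  rewrite -[X in normc X](subKr c) (le_lt_trans (le_normcD _ _))// normcN.
  have : (1 - normc c) * b <= (1 - normc c) * 2^-1.
    by rewrite ler_wpM2l// subr_ge0 ltW.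
  by move: c1 cc'; lra.
have wb : normc (blaschke c (x +i* y)) <= b.
  apply: le_trans (normc_blaschke_le c1 c'1) _.
  by rewrite ler_pdivrMr ?subr_gt0// mulrC ltW.
apply: le_lt_trans (energy_lipschitz c1 c'1 (le_trans wb b2)) _.
apply: le_lt_trans be; rewrite ler_wpM2l// mulr_ge0// ltW//.
Qed.

Lemma exists_energy_min : exists2 c, normc c < 1 &
  forall c', normc c' < 1 -> energy c <= energy c'.
Proof.
have [rho rho1 hrho] := energy_coercive.
(* The energy vanishes at 0, so 0 cannot lie in the region where it is positive. *)
have rho0 : 0 <= rho.
  rewrite leNgt; apply/negP => /ltW h.
  by have := hrho 0; rewrite energy0 normc0 ltxx => /(_ ltr01 h).
pose A := [set p : R * R | p.1 ^+ 2 + p.2 ^+ 2 <= rho ^+ 2].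
have AE p : A p <-> normc (p.1 +i* p.2) <= rho.
  have <- : (normc (p.1 +i* p.2) ^+ 2 <= rho ^+ 2) =
      (normc (p.1 +i* p.2) <= rho).
    by rewrite ler_pXn2r ?nnegrE ?normc_ge0.
  by rewrite sqr_normcE.
have A0 : A !=set0.
  by exists (0, 0); apply/AE; rewrite normc0.
have cA : compact A.
  apply: (@subclosed_compact _ _ (`[- rho, rho] `*` `[- rho, rho])).
  - apply: (@closed_comp _ _ (fun p : R * R => p.1 ^+ 2 + p.2 ^+ 2)
      [set x | x <= rho ^+ 2]); last exact: closed_le.
    move=> p _; apply: cvgD; rewrite expr2; apply: cvgM;
      by [exact: cvg_fst | exact: cvg_snd].
  - by apply: compact_setX; exact: segment_compact.
  - move=> [x y] /AE /= h; split; rewrite /= in_itv /= -ler_norml.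
    + exact: le_trans (normrRe_le (x +i* y)) h.
    + exact: le_trans (normrIm_le (x +i* y)) h.
have [|[x y] /set_mem/AE /= xy min] :=
    @compact_EVT_min _ R (fun p : R * R => energy (p.1 +i* p.2)) A A0 cA.
  apply: continuous_in_subspaceT => -[x y] /set_mem/AE /= h.
  exact: (@continuous_energy (x +i* y) (le_lt_trans h rho1)).
exists (x +i* y); first exact: le_lt_trans rho1.
move=> [x' y'] h'; have [h|/ltW h] := leP (normc (x' +i* y')) rho.
  by apply: (min (x', y')); rewrite inE; apply/AE.
(* Outside the compact disc the energy is positive, while its minimum inside is at most its value 0
   at the centre. *)
apply: ltW; apply: le_lt_trans (hrho _ h' h).
rewrite -energy0; apply: (min (0, 0)).
by rewrite inE; apply/AE; rewrite normc0.
Qed.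

(** * Uniqueness of the zero of the moment *)

Lemma moment_inj0 c c' : normc c < 1 -> normc c' < 1 ->
  moment c = 0 -> moment c' = 0 -> c = c'.
Proof.
move=> c1 c'1 Fc Fc'; apply: contrapT => cc'.
set w := blaschke c c'.
have w1 : normc w < 1 := normc_blaschke_lt1 c1 c'1.
have w0 : w != 0.
  rewrite mulf_neq0 ?invr_eq0 ?(subr1J_neq0 c1 (ltW c'1))// subr_eq0.
  exact/eqP.
(* By [blaschke_shift], k g_c' z equals w^* g_w (g_c z), so [Re_blaschke_add_gt0] makes the
   integrand below positive, although its integral is Re (k F c' + w^* F c) = 0. *)
pose k := w^* * - ((1 - c * c'^*) / (1 - c^* * c')).
have i1 := integrable_Re_blaschke k c'1.
have i2 := integrable_Re_blaschke w^* c1.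
have : 0 < \int[mu]_(z in D) (complex.Re (k * blaschke c' z) +
                              complex.Re (w^* * blaschke c z)).
  apply: Rintegral_gt0 => //; first by have := integrableD mD i1 i2.
  move=> z /D1 z1; rewrite /k -mulrA -blaschke_shift// ?(ltW z1)//.
  exact: Re_blaschke_add_gt0 (normc_blaschke_lt1 c1 z1).
rewrite RintegralD//.
have -> : \int[mu]_(z in D) complex.Re (k * blaschke c' z) =
    complex.Re (k * moment c') by rewrite -moment_linear.
have -> : \int[mu]_(z in D) complex.Re (w^* * blaschke c z) =
    complex.Re (w^* * moment c) by rewrite -moment_linear.
by rewrite Fc Fc' !mulr0 /= addr0 ltxx.
Qed.

End conformal_barycenter.

(* [c] is chosen before [theta]: it depends on [D] only, and is the unique zero
   in the disc whatever the value of [theta]. *)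
Theorem theorem1p1 (R : realType) (D : set R[i])
    (mD : measurable D)
    (D_disc : D `<=` unit_disc)
    (D_pos_fin : (0 < hyperbolic_measure D < +oo)%E) :
  exists c : R[i], forall theta : R, 0 <= theta < 2 * pi ->
    unique (fun c' : R[i] => unit_disc c' /\
      complex_integral hyperbolic_measure D (moebius theta c') = 0) c.
Proof.
have /andP[D0 Dfin] := D_pos_fin.
have D1 z : D z -> normc z < 1 by move=> /D_disc/unit_discE.
have [c c1 cmin] := exists_energy_min mD D1 D0 Dfin.
have Fc := moment_eq0 mD D1 D0 Dfin c1 cmin.
have e0 theta : @expi R theta != 0.
  apply/eqP => -[h1 h2]; have := cos2Dsin2 theta.
  by rewrite h1 h2 expr0n addr0 => /eqP; rewrite eq_sym oner_eq0.
exists c => theta _; split.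
  split; first exact/unit_discE.
  (* [moebius] unfolds to a constant multiple of [blaschke], so the phase leaves the integral. *)
  by rewrite [LHS](moment_linear mD D1 Dfin (expi theta) c1) Fc mulr0.
move=> c' [/unit_discE c'1].
rewrite [LHS](moment_linear mD D1 Dfin (expi theta) c'1) => /eqP.
rewrite mulf_eq0 (negbTE (e0 theta)) => /eqP Fc'.
exact: (moment_inj0 mD D1 D0 Dfin c1 c'1 Fc Fc').
Qed.
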